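(* Let $1<p,q,r<\infty$ be such that $\frac1q+\frac1p=1$ and $\frac1p=\frac1r-\frac12$. Then there is a constant $C_p$ depending only on $p$ such that for every Schwartz function $F\in\mathcal{S}(\mathbb{R})$, $$\int_{\mathbb{R}}|\widehat F(k^2)|^2\,dk\le C_p\,\|F\|_{L^q}\|F\|_{L^r}.$$ In particular, there is a constant $C$ such that for every $F\in\mathcal{S}(\mathbb{R})$, $$\Big(\int_{\mathbb{R}}|\widehat F(k^2)|^2\,dk\Big)^{1/2}\le C\,\|F\|_{L^{4/3}}.$$
   Context: $\widehat F(\xi)=\int_{\mathbb{R}}e^{-ix\xi}F(x)\,dx$ is the usual Fourier transform on $\mathbb{R}$; $L^s=L^s(\mathbb{R})$. *)

(* Defs.v *)
From HB Require Import structures.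
From mathcomp Require Import all_boot all_order all_algebra.
From mathcomp Require Import complex.
From mathcomp Require Import all_classical all_reals all_analysis.

Set Implicit Arguments.
Unset Strict Implicit.
Unset Printing Implicit Defensive.

Import Order.TTheory GRing.Theory Num.Theory.
Import numFieldNormedType.Exports.

Local Open Scope classical_set_scope.
Local Open Scope ring_scope.

Section ComplexValued.
Context {R : realType}.
Implicit Types (F : R -> R[i]) (z : R[i]).

Local Notation mu := (@lebesgue_measure R).

(* R-valued modulus; the norm `|z| of the library is R[i]-valued. *)
Definition cmod z : R := ComplexField.Normc.normc z.

Definition cderive1n (n : nat) F (x : R) : R[i] :=
  Complex ((derive1n n (fun t => complex.Re (F t))) x)
          ((derive1n n (fun t => complex.Im (F t))) x).

(* The library's derivative is a total operator, so existence of the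
   derivatives of all orders has to be required separately. *)
Definition smooth F : Prop :=
  forall (n : nat) (x : R),
    derivable (derive1n n (fun t => complex.Re (F t))) x 1 /\
    derivable (derive1n n (fun t => complex.Im (F t))) x 1.

Definition schwartz F : Prop :=
  smooth F /\
  forall m n : nat, exists M : R, forall x : R,
    `|x| ^+ m * cmod (cderive1n n F x) <= M.

Definition expi (t : R) : R[i] := Complex (cos t) (sin t).

Definition cintegral F : R[i] :=
  Complex (\int[mu]_x complex.Re (F x)) (\int[mu]_x complex.Im (F x)).

Definition fourier F (xi : R) : R[i] :=
  cintegral (fun x => expi (- (x * xi)) * F x).

Definition cLnorm (s : R) F : \bar R :=
  Lnorm mu s%:E (fun x => (cmod (F x))%:E).

End ComplexValued.

(* Main.v *)
Require Import Defs.
From HB Require Import structures.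
From mathcomp Require Import all_boot all_order all_algebra.
From mathcomp Require Import complex.
From mathcomp Require Import all_classical all_reals all_analysis.
From mathcomp Require Import measurable_realfun ring lra.

(** The proof reduces the restriction estimate to a Riesz potential. Write
[K_N(u)] for the integral of [exp (- i u k^2)] over [0 <= k <= N]. Expanding
the square and using Fubini, the integral of [|Fhat(k^2)|^2] over [0 <= k <= N]
is the double integral of [F(x) conj F(y) K_N(x - y)]. Van der Corput's estimate
bounds [|K_N(u)|] by a constant times [|u|^(-1/2)] uniformly in [N]
([norm_fresnel_le]), so letting [N] grow and using that [k |-> k^2] is even,
the left-hand side is at most a constant times the bilinear form

  I(f, h) = int int f(x) h(y) |x - y|^(-1/2) dx dy

at [f = h = |F|] ([restriction_le]).

Since [1/q + 1/p = 1] and [1/p = 1/r - 1/2] give [1/q + 1/r = 3/2], the form is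
bounded by [C ||f||_q ||h||_r] by the Hardy-Littlewood-Sobolev inequality, which
follows by integration from an inequality between integrands
([riesz_pointwise]). Let [a = f(x)^q], [b = h(y)^r],
[t = |x - y|], and let [phi_th(s)] be [s^(-1/2)] for [s <= 1] and [s^(-th)] for
[s > 1]. Then

  f(x) h(y) t^(-1/2) <= a b + b^2 phi_(q'/2)(b t) + a^2 phi_(r'/2)(a t),

where [q'] and [r'] are the conjugate exponents. Both [q'/2] and [r'/2] exceed
[1], so [phi] is integrable; integrating [phi(b (x - y))] in [x] costs a factor
[1/b], and the right-hand side integrates to at most a constant when [f] and [h]
have norm at most one ([riesz_form_le1]).

The second inequality is the case [p = 4], where [q = r = 4/3]. *)

Set Implicit Arguments.
Unset Strict Implicit.
Unset Printing Implicit Defensive.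

Import Order.TTheory GRing.Theory Num.Theory.
Import numFieldNormedType.Exports.

Local Open Scope classical_set_scope.
Local Open Scope ring_scope.

(** * Change of variables for Lebesgue measure *)

Section affine.
Context {R : realType}.
Local Notation mu := (@lebesgue_measure R).
Local Open Scope ereal_scope.

Local Notation pushforward_measure :=
  measure_function_pushforward__canonical__measure_function_Measure.

(** By uniqueness of Lebesgue measure it is enough to look at half-open
intervals; for negative [a] their preimages are half-open on the other side,
which does not affect the length. *)
Lemma lebesgue_measure_affine (a b : R) (A : set R) : a != 0%R ->
  measurable A ->
  mu ((fun x => a * x + b)%R @^-1` A) = (`|a|^-1)%:E * mu A.
Proof.
move=> a0 mA.
pose phi := fun x : measurableTypeR R => (a * x + b)%R : measurableTypeR R.
have mphi : measurable_fun [set: measurableTypeR R] phi.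
  by apply: measurable_funD => //; exact: measurable_funM.
pose m' := mscale (NngNum (normr_ge0 a)) (pushforward_measure mu mphi).
have /(_ A mA) -> : forall A, measurable A -> mu A = m' A.
  apply: lebesgue_measure_unique => _ [[c d] _ <-].
  rewrite -[LHS]/(mu `]c, d]) -[RHS]/(`|a|%:E * mu (phi @^-1` `]c, d])).
  have [alt0|agt0|] := ltgtP a 0%R; last by move/eqP; rewrite (negbTE a0).
  - have -> : phi @^-1` `]c, d] = `[((d - b) / a)%R, ((c - b) / a)%R[%classic.
      apply/seteqP; split => x /=; rewrite !in_itv/= /phi;
      by rewrite ler_ndivrMr// ltr_ndivlMr// lerBrDr ltrBlDr (mulrC x) =>
        /andP[-> ->].
    rewrite !lebesgue_measure_itv/= !lte_fin.
    rewrite ltr_nM2r ?invr_lt0// ltrD2r.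
    case: ifPn => cd; last by rewrite mule0.
    by rewrite -!EFinD -EFinM ltr0_norm//; congr EFin; field.
  - have -> : phi @^-1` `]c, d] = `]((c - b) / a)%R, ((d - b) / a)%R]%classic.
      apply/seteqP; split => x /=; rewrite !in_itv/= /phi;
      by rewrite ler_pdivlMr// ltr_pdivrMr// lerBrDr ltrBlDr (mulrC x) =>
        /andP[-> ->].
    rewrite !lebesgue_measure_itv/= !lte_fin.
    rewrite ltr_pM2r ?invr_gt0// ltrD2r.
    case: ifPn => cd; last by rewrite mule0.
    by rewrite -!EFinD -EFinM gtr0_norm//; congr EFin; field.
rewrite -[m' A]/(`|a|%:E * mu (phi @^-1` A)) muleA -EFinM.
by rewrite mulVf ?normr_eq0// mul1e.
Qed.

Lemma ge0_integral_affine (a b : R) (f : R -> \bar R) : a != 0%R ->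
  measurable_fun [set: R] f -> (forall x, 0 <= f x) ->
  \int[mu]_x f (a * x + b)%R = (`|a|^-1)%:E * \int[mu]_x f x.
Proof.
move=> a0 mf f0.
pose phi := fun x : measurableTypeR R => (a * x + b)%R : measurableTypeR R.
have mphi : measurable_fun [set: measurableTypeR R] phi.
  by apply: measurable_funD => //; exact: measurable_funM.
have k0 : (0 <= `|a|^-1)%R by rewrite invr_ge0.
rewrite -(@ge0_integral_mscale _ _ _ mu _ measurableT (NngNum k0))//.
transitivity (\int[pushforward_measure mu mphi]_x f x).
  by rewrite ge0_integral_pushforward.
apply: (@eq_measure_integral _ _ _ _ _ (pushforward_measure mu mphi)).
by move=> A mA _; exact: lebesgue_measure_affine.
Qed.

(** Stated for measurable functions: the kernel below is discontinuous, and for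
Fourier transforms measurability is what Fubini's theorem provides. *)
Lemma ge0_integral_even (f : R -> \bar R) : measurable_fun [set: R] f ->
  (forall x, 0 <= f x) -> (forall x, f (- x)%R = f x) ->
  \int[mu]_x f x = 2%:E * \int[mu]_(x in `[0%R, +oo[) f x.
Proof.
move=> mf f0 fN.
have E : \int[mu]_(x in `]-oo, 0%R]) f x = \int[mu]_(x in `[0%R, +oo[) f x.
  rewrite integral_mkcond [RHS]integral_mkcond.
  transitivity (\int[mu]_x (f \_ `[0%R, +oo[) (-1 * x + 0)%R).
    apply: eq_integral => x _; rewrite !patchE addr0 mulN1r fN.
    by rewrite !mem_setE !in_itv/= andbT oppr_ge0.
  rewrite ge0_integral_affine//.
  - by rewrite normrN1 invr1 mul1e.
  - exact/(measurable_restrictT _ _).1/measurable_funTS.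
  - by move=> x; rewrite patchE; case: ifP.
rewrite -(setUv (`]-oo, 0%R] : set R)) ge0_integral_setU//=; last 3 first.
  exact: measurableC.
  by rewrite setUv.
  exact/disj_setPCl.
rewrite setCitvl E integral_itv_obnd_cbnd; last exact: measurable_funTS.
by rewrite mule_natl mule2n.
Qed.

End affine.

(** * Elementary integrals *)

Section one_variable_integrals.
Context {R : realType}.
Local Notation mu := (@lebesgue_measure R).

Lemma continuous_FTC2_is_derive (f F : R -> R) (a b : R) : a < b ->
  {within `[a, b], continuous f} ->
  {in `[a, b], forall x, is_derive (x : R) (1 : R) F (f x)} ->
  (\int[mu]_(x in `[a, b]) (f x)%:E = (F b)%:E - (F a)%:E)%E.
Proof.
move=> ab cf dF.
have cF x : x \in `[a, b] -> F y @[y --> x] --> F x.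
  move=> /dF dFx; apply/differentiable_continuous/derivable1_diffP.
  by case: dFx.
apply: continuous_FTC2 => //.
  split.
  - move=> x xab; have xab' : x \in `[a, b] by exact: subset_itv_oo_cc.
    by case: (dF x xab').
  - by apply: cvg_at_right_filter; apply: cF; rewrite in_itv/= lexx ltW.
  - by apply: cvg_at_left_filter; apply: cF; rewrite in_itv/= lexx ltW.
move=> x xab; have xab' : x \in `[a, b] by exact: subset_itv_oo_cc.
by rewrite derive1E; case: (dF x xab').
Qed.

Lemma continuous_powR (s x : R) : 0 < x ->
  {for x, continuous (fun y : R => y `^ s)}.
Proof.
move=> x0; apply/differentiable_continuous/derivable1_diffP.
by apply: derivable_powR; rewrite in_itv/= x0.
Qed.

(** The integrand is unbounded at the origin, so the fundamental theorem of
calculus is applied between [1/(n+1)] and [1], and followed by monotone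
convergence. *)
Lemma integral_powR_itv01 :
  (\int[mu]_(t in `]0%R, 1%R]) (t `^ (- 2^-1))%:E <= 2%:E)%E.
Proof.
rewrite itv_open_bnd_bigcup.
have mf (A : set R) : measurable_fun A (fun t : R => (t `^ (- 2^-1))%:E).
  by apply/measurable_EFinP/measurable_funTS; exact: measurable_powR.
apply: (cvge_to_le (ge0_nondecreasing_set_cvg_integral _ _ _ _)) => //.
- apply/nondecreasing_seqP => n; rewrite subsetEset => x/=.
  rewrite !in_itv/= !add0r => /andP[nx ->]; rewrite andbT.
  by rewrite (le_trans _ nx)// lef_pV2 ?posrE// ler_nat.
- by move=> n; exact: mf.
- by move=> n x _; rewrite lee_fin powR_ge0.
apply: nearW => n; rewrite add0r.
have n0 : (0 : R) < n.+1%:R^-1 by rewrite invr_gt0.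
have [->|n1] := eqVneq (n.+1%:R^-1) (1:R).
  by rewrite set_itv1 integral_set1 lee_fin.
have {}n1 : n.+1%:R^-1 < 1 :> R by rewrite lt_neqAle n1 invf_le1// ler1n.
rewrite (@continuous_FTC2_is_derive _ (fun t => 2 * t `^ (2^-1)))//.
- by rewrite powR1 mulr1 -EFinB lee_fin gerBl// mulr_ge0// powR_ge0.
- apply/continuous_in_subspaceT => x; rewrite inE/= in_itv/= => /andP[nx _].
  by apply: continuous_powR; exact: lt_le_trans nx.
- move=> x; rewrite in_itv/= => /andP[nx _].
  have x0 : 0 < x by exact: lt_le_trans nx.
  have := is_derive1_powR 2^-1 x0.
  rewrite (_ : 2^-1 - 1 = - 2^-1); last by field.
  move=> d; have -> : x `^ (- 2^-1) = 2 *: (2^-1 * x `^ (- 2^-1)).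
    by rewrite /GRing.scale/=; field.
  exact: is_deriveZ.
Qed.

Lemma integral_powR_itv1y (th : R) : 1 < th ->
  (\int[mu]_(t in `[1%R, +oo[) (t `^ (- th))%:E = ((th - 1)^-1)%:E)%E.
Proof.
move=> th1.
have d1 (x : R) : 0 < x ->
    is_derive x 1 (fun t => (1 - th)^-1 * t `^ (1 - th)) (x `^ (- th)).
  move=> x0; have := is_derive1_powR (1 - th) x0.
  rewrite (_ : 1 - th - 1 = - th); last by ring.
  move=> d; have -> : x `^ (- th) = (1 - th)^-1 *: ((1 - th) * x `^ (- th)).
    by rewrite /GRing.scale/= mulrA mulVf ?mul1r// lt_eqF// subr_lt0.
  exact: is_deriveZ.
rewrite (@ge0_continuous_FTC2y _ _ (fun t => (1 - th)^-1 * t `^ (1 - th)) 1 0).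
- by rewrite powR1 mulr1 -EFinB sub0r -invrN opprB.
- by move=> x _; exact: powR_ge0.
- apply/continuous_in_subspaceT => x; rewrite inE/= in_itv/= andbT => nx.
  by apply: continuous_powR; exact: lt_le_trans nx.
- rewrite -[X in _ --> X](mulr0 (1 - th)^-1).
  apply: cvgMr.
  apply: (@cvg_trans _ (expR (- ((th - 1) * ln t)) @[t --> +oo])).
    by apply: near_eq_cvg; near=> t; rewrite /powR gt_eqF// -mulNr opprB.
  apply: cvg_comp (@cvgr_expR R).
  apply: gt0_cvgMry; first by rewrite subr_gt0.
  apply/cvgryPge => A; near=> t.
  by rewrite -(expRK A) ler_ln ?posrE ?expR_gt0.
- by move=> x x1; apply: ex_derive; apply: d1; exact: lt_trans x1.
- apply: cvg_at_right_filter.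
  have [/derivable1_diffP/differentiable_continuous + _] := d1 1 ltr01.
  exact.
- move=> x; rewrite in_itv/= andbT => x1; rewrite derive1E.
  have x0 : 0 < x by exact: lt_trans x1.
  by case: (d1 x x0).
Unshelve. all: by end_near. Qed.

End one_variable_integrals.

(** * A pointwise form of the Hardy-Littlewood-Sobolev inequality *)

Section pointwise_inequality.
Context {R : realType}.
Local Notation mu := (@lebesgue_measure R).

(** The kernel of exponent [1/2] near the origin, with its tail replaced by an
integrable power when [th > 1]. At [t = 0] the value is [0] because
[0 `^ (- 2^-1) = 0]. *)
Definition tail_kernel (th t : R) : R :=
  if `|t| <= 1 then `|t| `^ (- 2^-1) else `|t| `^ (- th).

Lemma tail_kernel_ge0 th t : 0 <= tail_kernel th t.
Proof. by rewrite /tail_kernel; case: ifP => _; exact: powR_ge0. Qed.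

Lemma measurable_tail_kernel th : measurable_fun [set: R] (tail_kernel th).
Proof.
have mp s : measurable_fun [set: R] (fun t => `|t| `^ s).
  exact: (measurableT_comp (measurable_powR s) (@normr_measurable R setT)).
apply: measurable_fun_ifT => //.
by apply: measurable_fun_ler => //; exact: normr_measurable.
Qed.

Lemma integral_tail_kernel th : 1 < th ->
  (\int[mu]_t (tail_kernel th t)%:E <= (4 + 2 / (th - 1))%:E)%E.
Proof.
move=> th1.
have mk (A : set R) : measurable_fun A (fun t => (tail_kernel th t)%:E).
  by apply/measurable_EFinP/measurable_funTS; exact: measurable_tail_kernel.
rewrite ge0_integral_even//; last 2 first.
- by move=> x; rewrite lee_fin tail_kernel_ge0.
- by move=> x; rewrite /tail_kernel normrN.
have -> : 4 + 2 / (th - 1) = 2 * (2 + (th - 1)^-1) by ring.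
rewrite EFinM lee_pmul2l// EFinD -(integral_powR_itv1y th1).
rewrite -integral_itv_obnd_cbnd; last exact: mk.
have -> : `]0%R, +oo[%classic = `]0%R, 1%R] `|` `]1%R, +oo[ :> set R.
  by rewrite (@itv_bndbnd_setU _ _ _ (BRight 1%R)) ?bnd_simp.
rewrite ge0_integral_setU//=; last 3 first.
- exact: mk.
- by move=> x _; rewrite lee_fin tail_kernel_ge0.
- apply/disj_setPS => x [] /=; rewrite !in_itv/= => /andP[_ x1].
  by rewrite andbT ltNge x1.
rewrite [X in (_ + X <= _)%E]integral_itv_obnd_cbnd; last exact: mk.
rewrite leeD//.
- apply: le_trans integral_powR_itv01; rewrite le_eqVlt; apply/orP; left.
  apply/eqP; apply: eq_integral => x; rewrite inE/= in_itv/= => /andP[x0 x1].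
  by rewrite /tail_kernel gtr0_norm// x1.
- rewrite le_eqVlt; apply/orP; left.
  apply/eqP; apply: eq_integral => x; rewrite inE/= in_itv/= andbT => x1.
  rewrite /tail_kernel ger0_norm ?(le_trans ler01)//; case: ifPn => // x1'.
  have -> : x = 1 by apply/eqP; rewrite eq_le x1' x1.
  by rewrite !powR1.
Qed.

(** The bound is the same for all centres [y] and scales like [1 / b]; this is
the only property of the kernel that the bilinear estimate uses. *)
Lemma integral_tail_kernel_affine th b y : 1 < th -> 0 < b ->
  (\int[mu]_x (tail_kernel th (b * (x - y)))%:E
     <= ((4 + 2 / (th - 1)) / b)%:E)%E.
Proof.
move=> th1 b0.
have -> : (fun x => (tail_kernel th (b * (x - y)))%:E) =
    (fun x => (EFin \o tail_kernel th) (b * x + - (b * y))%R).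
  by apply/funext => x /=; rewrite mulrBr.
rewrite ge0_integral_affine ?gt_eqF//; last 2 first.
- by apply/measurable_EFinP; exact: measurable_tail_kernel.
- by move=> x; rewrite lee_fin tail_kernel_ge0.
rewrite gtr0_norm// mulrC EFinM lee_pmul2l ?lte_fin ?invr_gt0//.
exact: integral_tail_kernel.
Qed.

Lemma powR_mul_powR (x a b : R) : 0 < x -> x `^ a * x `^ b = x `^ (a + b).
Proof. by move=> x0; rewrite powRD// (gt_eqF x0) implybT. Qed.

(** With [b = h `^ r] and [a = f `^ q / b <= 1], homogeneity
([1/q + 1/r + 1/2 = 2]) turns the left-hand side into
[b ^ 2 * a^(1/q) * (b t)^(-1/2)]. If [b t <= 1], dropping [a^(1/q) <= 1] leaves
the singular part of the kernel. If [b t > 1], Young's inequality with the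
conjugate exponents [q] and [q / (q - 1)] separates [a], which rebuilds
[f `^ q * h `^ r], from a power of [b t] that is integrable at infinity as soon
as [q < 2]. *)
Lemma riesz_pointwise_half (q r f h t : R) : 1 < q -> 1 < r ->
  q^-1 + r^-1 = 3 / 2 -> 0 <= f -> 0 <= h -> 0 < t -> f `^ q <= h `^ r ->
  f * h * t `^ (- 2^-1) <= f `^ q * h `^ r +
    (h `^ r) ^+ 2 * tail_kernel (q / (q - 1) / 2) (h `^ r * t).
Proof.
move=> q1 r1 qr f0 h0 t0 fh.
have q0 : 0 < q by exact: lt_trans q1.
have r0 : 0 < r by exact: lt_trans r1.
have [h_eq0|hn0] := eqVneq h 0.
  rewrite h_eq0 mulr0 mul0r; apply: addr_ge0;
  by rewrite mulr_ge0 ?sqr_ge0 ?powR_ge0 ?tail_kernel_ge0.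
have {hn0}h0 : 0 < h by rewrite lt_neqAle eq_sym hn0.
set b := h `^ r; have b0 : 0 < b by exact: powR_gt0.
have fE : f = (f `^ q) `^ q^-1 by rewrite -powRrM mulfV ?gt_eqF// powRr1.
have hE : h = b `^ r^-1 by rewrite -powRrM mulfV ?gt_eqF// powRr1 ?ltW.
have bE : b ^+ 2 = b `^ q^-1 * b `^ r^-1 * b `^ 2^-1.
  rewrite -(powR_mulrn _ (ltW b0)) 2!(powR_mul_powR _ _ b0) qr.
  by congr (_ `^ _); field.
have bt0 : 0 < b * t by exact: mulr_gt0.
have tE : t `^ (- 2^-1) = b `^ 2^-1 * (b * t) `^ (- 2^-1).
  rewrite powRM ?ltW// mulrA powR_mul_powR// subrr powRr0 mul1r//.
have K0 : 0 <= (b * t) `^ (- 2^-1) by exact: powR_ge0.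
rewrite /tail_kernel (ger0_norm (ltW bt0)).
have fb : f <= b `^ q^-1.
  rewrite [leLHS]fE; apply: ge0_ler_powR => //.
  - by rewrite invr_ge0 ltW.
  - by rewrite nnegrE powR_ge0.
  - by rewrite nnegrE ltW.
case: ifPn => [_|].
  rewrite -[leLHS]add0r lerD ?mulr_ge0 ?powR_ge0 ?(ltW b0)//.
  rewrite bE tE [in leLHS]hE !mulrA ler_wpM2r// ler_wpM2r ?powR_ge0//.
  by rewrite ler_wpM2r ?powR_ge0.
rewrite -ltNge => bt1.
set a := f `^ q / b.
have a0 : 0 <= a by rewrite divr_ge0 ?powR_ge0 ?ltW.
have aE : f = a `^ q^-1 * b `^ q^-1.
  by rewrite -powRM ?(ltW b0)// /a divfK ?gt_eqF.
have q10 : 0 < q - 1 by rewrite subr_gt0.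
set s := q / (q - 1); have s0 : 0 < s by exact: divr_gt0.
have s1 : 1 < s by rewrite /s ltr_pdivlMr// mul1r gtrBl.
have := conjugate_powR (powR_ge0 a q^-1) K0 q0 s0.
rewrite -!powRrM mulVf ?gt_eqF// powRr1//.
have -> : q^-1 + s^-1 = 1 by rewrite /s; field; rewrite !gt_eqF.
have -> : - 2^-1 * s = - (s / 2) by field.
move=> /(_ erefl) young.
have {}young : a `^ q^-1 * (b * t) `^ (- 2^-1) <= a + (b * t) `^ (- (s / 2)).
  apply: le_trans young _; rewrite lerD//.
    by rewrite ler_pdivrMr// ler_peMr// ltW.
  by rewrite ler_pdivrMr// ler_peMr ?powR_ge0// ltW.
have -> : f * h * t `^ (- 2^-1) =
    b ^+ 2 * (a `^ q^-1 * (b * t) `^ (- 2^-1)).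
  by rewrite bE tE {1}aE [in LHS]hE; ring.
have -> : f `^ q * b = b ^+ 2 * a by rewrite /a; field; rewrite gt_eqF.
by rewrite -mulrDr ler_wpM2l// exprn_ge0// ltW.
Qed.

(** Hardy-Littlewood-Sobolev before integration: after integrating in both
variables, each term on the right is controlled by the integrals of [f `^ q] and
[h `^ r] alone, since integrating the tail kernel in the variable that its
dilation factor does not depend on produces the inverse of that factor. *)
Lemma riesz_pointwise (q r f h u : R) : 1 < q -> 1 < r ->
  q^-1 + r^-1 = 3 / 2 -> 0 <= f -> 0 <= h ->
  f * h * `|u| `^ (- 2^-1) <= f `^ q * h `^ r +
    (h `^ r) ^+ 2 * tail_kernel (q / (q - 1) / 2) (h `^ r * u) +
    (f `^ q) ^+ 2 * tail_kernel (r / (r - 1) / 2) (f `^ q * u).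
Proof.
move=> q1 r1 qr f0 h0.
have T0 x th z : 0 <= x ^+ 2 * tail_kernel th z.
  by rewrite mulr_ge0 ?sqr_ge0 ?tail_kernel_ge0.
have [->|u0] := eqVneq u 0.
  have z : - 2^-1 != 0 :> R by rewrite oppr_eq0 invr_eq0.
  by rewrite normr0 (powR0 z) mulr0 !addr_ge0 ?T0// mulr_ge0 ?powR_ge0.
have tkN x th : 0 <= x -> tail_kernel th (x * u) = tail_kernel th (x * `|u|).
  by move=> x0; rewrite /tail_kernel !normrM normr_id.
have nu0 : 0 < `|u| by rewrite normr_gt0.
rewrite !tkN ?powR_ge0//.
have [fh|/ltW hf] := leP (f `^ q) (h `^ r).
  apply: le_trans (riesz_pointwise_half q1 r1 qr f0 h0 nu0 fh) _.
  by rewrite lerDl.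
rewrite addrAC (mulrC f) (mulrC (f `^ q)).
rewrite addrC in qr.
apply: le_trans (riesz_pointwise_half r1 q1 qr h0 f0 nu0 hf) _.
by rewrite lerDl.
Qed.

End pointwise_inequality.

(** * The Hardy-Littlewood-Sobolev inequality of order one half *)

Section hardy_littlewood_sobolev.
Context {R : realType}.
Local Notation mu := (@lebesgue_measure R).

(** The bound for the integral of [tail_kernel] whose tail exponent is half the
exponent conjugate to [q]. *)
Definition riesz_const (q : R) : R := 4 + 2 / (q / (q - 1) / 2 - 1).

Lemma riesz_const_ge0 (q : R) : 1 < q -> q < 2 -> 0 <= riesz_const q.
Proof.
move=> q1 q2; rewrite addr_ge0// divr_ge0// subr_ge0.
rewrite ler_pdivlMr// mul1r ler_pdivlMr ?subr_gt0//; lra.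
Qed.

Lemma measurable_fun_tail_kernel_scaled (th : R) (b : R -> R) :
  measurable_fun [set: R] b ->
  measurable_fun [set: R * R] (fun z : R * R =>
    b z.2 ^+ 2 * tail_kernel th (b z.2 * (z.1 - z.2))).
Proof.
move=> mb.
have mb2 : measurable_fun [set: R * R] (fun z : R * R => b z.2).
  by apply: measurableT_comp => //; exact: measurable_snd.
apply: measurable_funM; first exact: measurable_funX.
apply: measurableT_comp; first exact: measurable_tail_kernel.
apply: measurable_funM => //; apply: measurable_funB.
  exact: measurable_fst.
exact: measurable_snd.
Qed.

Lemma integral_tail_kernel_scaled (q b y : R) : 1 < q -> q < 2 -> 0 <= b ->
  (\int[mu]_x (b ^+ 2 * tail_kernel (q / (q - 1) / 2) (b * (x - y)))%:E
    <= (riesz_const q)%:E * b%:E)%E.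
Proof.
move=> q1 q2; rewrite le_eqVlt => /predU1P[<-|b0].
  under eq_integral do rewrite expr0n/= mul0r.
  by rewrite integral0 mule0.
have th1 : 1 < q / (q - 1) / 2.
  rewrite ltr_pdivlMr// ltr_pdivlMr ?subr_gt0//; lra.
under eq_integral do rewrite EFinM.
rewrite ge0_integralZl//; last 3 first.
- apply/measurable_EFinP; apply: measurableT_comp.
    exact: measurable_tail_kernel.
  by apply: measurable_funM => //; exact: measurable_funB.
- by move=> x _; rewrite lee_fin tail_kernel_ge0.
- by rewrite lee_fin sqr_ge0.
apply: le_trans (lee_wpmul2l _ (integral_tail_kernel_affine y th1 b0)) _.
  by rewrite lee_fin sqr_ge0.
rewrite -!EFinM lee_fin /riesz_const expr2 le_eqVlt; apply/orP; left.
by apply/eqP; field; rewrite ?gt_eqF//; lra.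
Qed.

Lemma integral2_tail_kernel_scaled (q : R) (b : R -> R) : 1 < q -> q < 2 ->
  measurable_fun [set: R] b -> (forall y, 0 <= b y) ->
  (\int[mu]_y (b y)%:E <= 1)%E ->
  (\int[(mu \x mu)%E]_z
     (b z.2 ^+ 2 * tail_kernel (q / (q - 1) / 2) (b z.2 * (z.1 - z.2)))%:E
    <= (riesz_const q)%:E)%E.
Proof.
move=> q1 q2 mb b0 ib.
rewrite fubini_tonelli2//=; last 2 first.
- by apply/measurable_EFinP; exact: measurable_fun_tail_kernel_scaled.
- by move=> z; rewrite lee_fin mulr_ge0 ?sqr_ge0 ?tail_kernel_ge0.
rewrite -[leRHS]mule1.
apply: le_trans (lee_wpmul2l _ ib); last by rewrite lee_fin riesz_const_ge0.
rewrite -ge0_integralZl//; last 3 first.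
- exact/measurable_EFinP.
- by move=> y _; rewrite lee_fin.
- by rewrite lee_fin riesz_const_ge0.
apply: ge0_le_integral => //.
- move=> y _; apply: integral_ge0 => x _.
  by rewrite lee_fin mulr_ge0 ?sqr_ge0 ?tail_kernel_ge0.
- apply: (@measurable_fun_fubini_tonelli_G _ _ _ _ _ mu (fun z => (b z.2 ^+ 2 *
    tail_kernel (q / (q - 1) / 2) (b z.2 * (z.1 - z.2)))%:E)) => //.
  + by apply/measurable_EFinP; exact: measurable_fun_tail_kernel_scaled.
  + by move=> z; rewrite lee_fin mulr_ge0 ?sqr_ge0 ?tail_kernel_ge0.
- by apply: measurable_funeM; exact/measurable_EFinP.
- by move=> y _; rewrite /fubini_G/=; exact: integral_tail_kernel_scaled.
Qed.

Lemma ge0_integral_prod_swap (F : R * R -> \bar R) :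
  measurable_fun [set: R * R] F -> (forall z, 0 <= F z)%E ->
  (\int[(mu \x mu)%E]_z F (z.2, z.1) = \int[(mu \x mu)%E]_z F z)%E.
Proof.
move=> mF F0; rewrite fubini_tonelli1//= ?[RHS]fubini_tonelli2//.
exact: (measurableT_comp mF (@measurable_swap _ _ _ _)).
Qed.

Lemma measurable_fun_riesz_kernel :
  measurable_fun [set: R * R] (fun z : R * R => `|z.1 - z.2| `^ (- 2^-1)).
Proof.
apply: (measurableT_comp (measurable_powR (- 2^-1))).
apply: measurableT_comp; first exact: normr_measurable.
by apply: measurable_funB; [exact: measurable_fst|exact: measurable_snd].
Qed.

Lemma measurable_fun_prod_mul (f h : R -> R) :
  measurable_fun [set: R] f -> measurable_fun [set: R] h ->
  measurable_fun [set: R * R] (fun z : R * R => f z.1 * h z.2).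
Proof.
move=> mf mh; apply: measurable_funM.
  by apply: measurableT_comp => //; exact: measurable_fst.
by apply: measurableT_comp => //; exact: measurable_snd.
Qed.

(** Integrating [riesz_pointwise]: the three terms contribute [1],
[riesz_const q] and [riesz_const r]. *)
Lemma riesz_form_le1 (q r : R) (f h : R -> R) : 1 < q -> 1 < r ->
  q^-1 + r^-1 = 3 / 2 ->
  measurable_fun [set: R] f -> measurable_fun [set: R] h ->
  (forall x, 0 <= f x) -> (forall x, 0 <= h x) ->
  (\int[mu]_x (f x `^ q)%:E <= 1)%E -> (\int[mu]_x (h x `^ r)%:E <= 1)%E ->
  (\int[(mu \x mu)%E]_z (f z.1 * h z.2 * `|z.1 - z.2| `^ (- 2^-1))%:E
    <= (1 + riesz_const q + riesz_const r)%:E)%E.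
Proof.
move=> q1 r1 qr mf mh f0 h0 if1 ih1.
have half (s : R) : 1 < s -> s^-1 < 1.
  by move=> s1; rewrite invf_lt1// (lt_trans ltr01).
have lt2 (s s' : R) : 1 < s -> 1 < s' -> s^-1 + s'^-1 = 3 / 2 -> s < 2.
  move=> s1 s1' ss'; have s0 : 0 < s by exact: lt_trans s1.
  rewrite -[ltRHS]invrK -[ltLHS]invrK ltf_pV2 ?posrE ?invr_gt0//.
  have := half _ s1'; lra.
have q2 : q < 2 by exact: lt2 qr.
have r2 : r < 2 by apply: (lt2 _ q) => //; rewrite addrC.
have mfq : measurable_fun [set: R] (fun x => f x `^ q).
  exact: (measurableT_comp (measurable_powR q)).
have mhr : measurable_fun [set: R] (fun x => h x `^ r).
  exact: (measurableT_comp (measurable_powR r)).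
pose A (z : R * R) := f z.1 `^ q * h z.2 `^ r.
pose B (z : R * R) := (h z.2 `^ r) ^+ 2 *
  tail_kernel (q / (q - 1) / 2) (h z.2 `^ r * (z.1 - z.2)).
pose C (z : R * R) := (f z.1 `^ q) ^+ 2 *
  tail_kernel (r / (r - 1) / 2) (f z.1 `^ q * (z.1 - z.2)).
have A0 z : 0 <= A z by rewrite mulr_ge0 ?powR_ge0.
have B0 z : 0 <= B z by rewrite mulr_ge0 ?sqr_ge0 ?tail_kernel_ge0.
have C0 z : 0 <= C z by rewrite mulr_ge0 ?sqr_ge0 ?tail_kernel_ge0.
have mA : measurable_fun [set: R * R] A.
  exact: (measurable_fun_prod_mul mfq mhr).
have mB : measurable_fun [set: R * R] B.
  exact: (measurable_fun_tail_kernel_scaled _ mhr).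
pose C' (z : R * R) := (f z.2 `^ q) ^+ 2 *
  tail_kernel (r / (r - 1) / 2) (f z.2 `^ q * (z.1 - z.2)).
have mC' : measurable_fun [set: R * R] C'.
  exact: (measurable_fun_tail_kernel_scaled _ mfq).
have CE z : C z = C' (z.2, z.1).
  by rewrite /C /C' /tail_kernel/= !normrM (distrC z.1).
have mC : measurable_fun [set: R * R] C.
  rewrite (_ : C = C' \o (fun z => (z.2, z.1))); last exact/funext.
  exact: (measurableT_comp mC' (@measurable_swap _ _ _ _)).
have iA : (\int[(mu \x mu)%E]_z (A z)%:E <= 1)%E.
  have meA := (measurable_EFinP _ _).2 mA.
  rewrite fubini_tonelli1//=.
  apply: le_trans if1; apply: ge0_le_integral => //.
  - move=> x _; apply: integral_ge0 => y _; rewrite lee_fin; exact: (A0 (x, y)).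
  - exact: (@measurable_fun_fubini_tonelli_F _ _ _ _ _ mu (EFin \o A)).
  - exact: ((measurable_EFinP _ _).2 mfq).
  - move=> x _; rewrite /fubini_F/= /A/=.
    under eq_integral do rewrite EFinM.
    rewrite ge0_integralZl//; last 3 first.
    + exact: ((measurable_EFinP _ _).2 mhr).
    + by move=> y _; rewrite lee_fin powR_ge0.
    + by rewrite lee_fin powR_ge0.
    by rewrite -[leRHS]mule1 lee_wpmul2l// lee_fin powR_ge0.
have iB : (\int[(mu \x mu)%E]_z (B z)%:E <= (riesz_const q)%:E)%E.
  exact: (integral2_tail_kernel_scaled q1 q2 mhr (fun y => powR_ge0 _ _) ih1).
have iC : (\int[(mu \x mu)%E]_z (C z)%:E <= (riesz_const r)%:E)%E.
  have C'0 z : (0 <= (EFin \o C') z)%E.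
    by rewrite lee_fin mulr_ge0 ?sqr_ge0 ?tail_kernel_ge0.
  have E := ge0_integral_prod_swap ((measurable_EFinP _ _).2 mC') C'0.
  apply: (@le_trans _ _ (\int[(mu \x mu)%E]_z (C' z)%:E)%E).
    by rewrite -[leRHS]E le_eqVlt; apply/orP; left; apply/eqP;
      apply: eq_integral => z _; rewrite CE.
  exact: (integral2_tail_kernel_scaled r1 r2 mfq (fun y => powR_ge0 _ _) if1).
have ABC z : f z.1 * h z.2 * `|z.1 - z.2| `^ (- 2^-1) <= A z + B z + C z.
  exact: riesz_pointwise.
(* only the bounds on [A], [B] and [C] are used from here on *)
clear CE mC' C'; clearbody A B C.
have meA := (measurable_EFinP _ _).2 mA.
have meB := (measurable_EFinP _ _).2 mB.
have meC := (measurable_EFinP _ _).2 mC.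
apply: (@le_trans _ _ (\int[(mu \x mu)%E]_z (A z + B z + C z)%:E)%E).
  apply: ge0_le_integral => //.
  - by move=> z _; rewrite lee_fin mulr_ge0 ?powR_ge0 ?(mulr_ge0 (f0 _) (h0 _)).
  - apply/measurable_EFinP; apply: measurable_funM.
      exact: (measurable_fun_prod_mul mf mh).
    exact: measurable_fun_riesz_kernel.
  - apply/measurable_EFinP; apply: measurable_funD; last exact: mC.
    exact: (measurable_funD mA mB).
  - by move=> z _; rewrite lee_fin.
under eq_integral do rewrite 2!EFinD.
rewrite ge0_integralD//; last 3 first.
- by move=> z _; rewrite -EFinD lee_fin addr_ge0.
- exact: (emeasurable_funD meA meB).
- by move=> z _; rewrite lee_fin.
rewrite ge0_integralD//; last 2 first.
- by move=> z _; rewrite lee_fin.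
- by move=> z _; rewrite lee_fin.
by rewrite !EFinD; apply: leeD => //; apply: leeD.
Qed.

Lemma integral_powR_div_le1 (s e : R) (f : R -> R) : 1 < s -> 0 < e ->
  measurable_fun [set: R] f -> (forall x, 0 <= f x) ->
  (Lnorm mu s%:E (EFin \o f) < +oo)%E ->
  (\int[mu]_x ((f x / (fine (Lnorm mu s%:E (EFin \o f)) + e)) `^ s)%:E <= 1)%E.
Proof.
move=> s1 e0 mf f0 Nfin; set n := fine _.
have s0 : 0 < s by exact: lt_trans s1.
have Nn : Lnorm mu s%:E (EFin \o f) = n%:E.
  by rewrite fineK// ge0_fin_numE// Lnorm_ge0.
have n0 : 0 <= n by rewrite fine_ge0// Lnorm_ge0.
have ne0 : 0 < n + e by rewrite ltr_wpDl.
have E : (\int[mu]_x (f x `^ s)%:E = (n `^ s)%:E)%E.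
  have sn0 : s != 0 by rewrite gt_eqF.
  have := poweR_Lnorm mu (EFin \o f) sn0; rewrite Nn poweR_EFin => ->.
  by apply: eq_integral => x _ /=; rewrite ger0_norm.
have V0 : 0 <= (n + e)^-1 by rewrite invr_ge0 ltW.
under eq_integral => x _ do rewrite (powRM _ (f0 x) V0) EFinM.
rewrite ge0_integralZr//; last 3 first.
- apply/measurable_EFinP; exact: (measurableT_comp (measurable_powR s)).
- by move=> x _; rewrite lee_fin powR_ge0.
- by rewrite lee_fin powR_ge0.
rewrite E -EFinM lee_fin -(powRM _ n0 V0) -[leRHS](congr1 (@^~ s) (@powR1 R)).
apply: ge0_ler_powR; rewrite ?nnegrE ?(ltW s0)// ?mulr_ge0//.
by rewrite ler_pdivrMr// mul1r lerDl ltW.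
Qed.

(** Normalising by the norms would break down when one of them vanishes;
dividing by the norms plus [e] and letting [e] go to [0] avoids this case
distinction. *)
Lemma hardy_littlewood_sobolev_half (q r : R) (f h : R -> R) : 1 < q -> 1 < r ->
  q^-1 + r^-1 = 3 / 2 ->
  measurable_fun [set: R] f -> measurable_fun [set: R] h ->
  (forall x, 0 <= f x) -> (forall x, 0 <= h x) ->
  (Lnorm mu q%:E (EFin \o f) < +oo)%E -> (Lnorm mu r%:E (EFin \o h) < +oo)%E ->
  (\int[(mu \x mu)%E]_z (f z.1 * h z.2 * `|z.1 - z.2| `^ (- 2^-1))%:E
    <= (1 + riesz_const q + riesz_const r)%:E *
       Lnorm mu q%:E (EFin \o f) * Lnorm mu r%:E (EFin \o h))%E.
Proof.
move=> q1 r1 qr mf mh f0 h0 Nf Nh.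
set C := 1 + _ + _; set a := Lnorm mu q%:E _; set b := Lnorm mu r%:E _.
pose n := fine a; pose m := fine b.
have aE : a = n%:E by rewrite fineK// ge0_fin_numE// Lnorm_ge0.
have bE : b = m%:E by rewrite fineK// ge0_fin_numE// Lnorm_ge0.
have n0 : 0 <= n by rewrite fine_ge0// Lnorm_ge0.
have m0 : 0 <= m by rewrite fine_ge0// Lnorm_ge0.
have mform : measurable_fun [set: R * R]
    (fun z : R * R => f z.1 * h z.2 * `|z.1 - z.2| `^ (- 2^-1)).
  exact: (measurable_funM (measurable_fun_prod_mul mf mh)
    measurable_fun_riesz_kernel).
set I := (\int[_]_z _)%E.
have scaled e : 0 < e -> (I <= ((n + e) * (m + e) * C)%:E)%E.
  move=> e0.
  have ne0 : 0 < n + e by rewrite ltr_wpDl.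
  have me0 : 0 < m + e by rewrite ltr_wpDl.
  have mfe : measurable_fun [set: R] (fun x => f x / (n + e)).
    exact: measurable_funM.
  have mhe : measurable_fun [set: R] (fun x => h x / (m + e)).
    exact: measurable_funM.
  have fe0 x : 0 <= f x / (n + e) by rewrite divr_ge0// ltW.
  have he0 x : 0 <= h x / (m + e) by rewrite divr_ge0// ltW.
  have := riesz_form_le1 q1 r1 qr mfe mhe fe0 he0
    (integral_powR_div_le1 q1 e0 mf f0 Nf) (integral_powR_div_le1 r1 e0 mh h0 Nh).
  rewrite -/C => le1.
  have -> : I = (((n + e) * (m + e))%:E * \int[(mu \x mu)%E]_z
      (f z.1 / (n + e) * (h z.2 / (m + e)) * `|z.1 - z.2| `^ (- 2^-1))%:E)%E.
    rewrite -ge0_integralZl//.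
    - apply: eq_integral => z _; rewrite -EFinM; congr EFin.
      by field; rewrite !gt_eqF.
    - apply/measurable_EFinP.
      exact: (measurable_funM (measurable_fun_prod_mul mfe mhe)
        measurable_fun_riesz_kernel).
    - by move=> z _; rewrite lee_fin (mulr_ge0 _ (powR_ge0 _ _))//
        (mulr_ge0 (fe0 _) (he0 _)).
    - by rewrite lee_fin mulr_ge0// ltW.
  by rewrite [leRHS]EFinM lee_wpmul2l// lee_fin mulr_ge0// ltW.
have C0 : 0 <= C.
  have /(le_trans _) := scaled 1 ltr01 => /(_ 0%E).
  rewrite lee_fin pmulr_rge0 ?mulr_gt0 ?ltr_wpDl//; apply.
  by apply: integral_ge0 => z _; rewrite lee_fin !mulr_ge0 ?powR_ge0.
rewrite aE bE -!EFinM; apply/lee_addgt0Pr => e e0.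
(* for [d <= 1], replacing the norms by norms plus [d] costs at most [d * K] *)
pose K := C * (n + m + 1) + 1.
have K0 : 0 < K by rewrite ltr_wpDl// mulr_ge0// !addr_ge0.
pose d := Num.min 1 (e / K).
have d0 : 0 < d by rewrite lt_min ltr01 divr_gt0.
have d1 : d <= 1 by rewrite ge_min lexx.
have dK : d * K <= e by rewrite -ler_pdivlMr// ge_min lexx orbT.
apply: (le_trans (scaled d d0)); rewrite -EFinD lee_fin.
apply: le_trans (_ : C * n * m + d * K <= _); last by rewrite lerD2l.
rewrite /K.
have -> : (n + d) * (m + d) * C = C * n * m + d * (C * (n + m + d)) by ring.
rewrite lerD2l ler_wpM2l ?(ltW d0)// (@le_trans _ _ (C * (n + m + 1)))//.
  by rewrite ler_wpM2l// lerD2l.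
by rewrite lerDl.
Qed.

End hardy_littlewood_sobolev.

(** * Truncated Fresnel integrals *)

Section fresnel.
Context {R : realType}.
Local Notation mu := (@lebesgue_measure R).

Lemma continuous_cos_sqr (u c : R) :
  continuous (fun k : R => cos (u * k ^+ 2 + c)).
Proof.
move=> x; apply: (@continuous_comp _ _ _ (fun k : R => u * k ^+ 2 + c) cos).
  apply: cvgD; last exact: cvg_cst.
  by apply: cvgMr; exact: exprn_continuous.
exact: continuous_cos.
Qed.

Lemma integrable_cos_sqr (u c a b : R) :
  mu.-integrable `[a, b] (fun k => (cos (u * k ^+ 2 + c))%:E).
Proof.
apply: continuous_compact_integrable; first exact: segment_compact.
by apply: continuous_subspaceT; exact: continuous_cos_sqr.
Qed.

(** Van der Corput's second derivative test. Since
[cos (u k^2 + c) = (sin (u k^2 + c) / (2 u k))' + sin (u k^2 + c) / (2 u k^2)]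
and the last term is at most [1 / (2 |u| k^2)] in absolute value, the cosine is
dominated by the derivative of [(sin (u k^2 + c) / (2 u) - 1 / (2 |u|)) / k]. *)
Lemma fresnel_tail_le (u c d N : R) : u != 0 -> 0 < d -> d < N ->
  \int[mu]_(k in `[d, N]) cos (u * k ^+ 2 + c) <= (`|u| * d)^-1.
Proof.
move=> u0 d0 dN.
pose b := (2 * u)^-1; pose a := (2 * `|u|)^-1.
pose G (k : R) := (b * sin (u * k ^+ 2 + c) - a) * k^-1.
pose g (k : R) := cos (u * k ^+ 2 + c) +
  k ^- 2 * (a - b * sin (u * k ^+ 2 + c)).
have a0 : 0 < a by rewrite invr_gt0 mulr_gt0// normr_gt0.
have ab : `|b| = a by rewrite /b normfV normrM ger0_norm.
have bs x : `|b * sin x| <= a.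
  rewrite normrM ab ler_piMr ?(ltW a0)// ler_norml sin_geN1 sin_le1//.
have dG (k : R) : 0 < k -> is_derive (k : R) (1 : R) G (g k).
  move=> k0; have kn0 : k != 0 by rewrite gt_eqF.
  have dq : is_derive k 1 (fun k : R => u * k ^+ 2 + c) (2 * u * k).
    by apply: is_derive_eq; rewrite /GRing.scale/=; ring.
  have ds : is_derive k 1 (fun k : R => sin (u * k ^+ 2 + c))
      (cos (u * k ^+ 2 + c) * (2 * u * k)).
    exact: (@is_derive1_comp _ sin (fun k : R => u * k ^+ 2 + c)).
  have dw : is_derive k 1 (fun k : R => b * sin (u * k ^+ 2 + c) - a)
      (b * (cos (u * k ^+ 2 + c) * (2 * u * k))).
    have := is_deriveB (is_deriveZ b ds) (is_derive_cst a k 1).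
    by rewrite subr0.
  have dv : is_derive k 1 (fun k : R => k^-1) (- k ^- 2).
    by have := is_deriveV kn0 (is_derive_id k 1); rewrite /GRing.scale/= mulr1.
  apply: (is_derive_eq (is_deriveM dw dv)).
  rewrite -[LHS]/((b * sin (u * k ^+ 2 + c) - a) * (- k ^- 2) +
    k^-1 * (b * (cos (u * k ^+ 2 + c) * (2 * u * k)))) /g.
  have bu : b * (2 * u) = 1 by rewrite mulVf// mulf_neq0.
  move: (sin _) (cos _) (a) (b) bu => S C a' b' bu.
  transitivity (b' * (2 * u) * C * (k^-1 * k) + k ^- 2 * (a' - b' * S)).
    by ring.
  by rewrite bu mulVf// mulr1 mul1r.
have cg (k : R) : 0 < k -> {for k, continuous g}.
  move=> k0; have kn0 : k != 0 by rewrite gt_eqF.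
  apply: cvgD; first exact: continuous_cos_sqr.
  apply: cvgM.
    by apply: cvgV; [rewrite expf_neq0|exact: exprn_continuous].
  apply: cvgB; first exact: cvg_cst.
  apply: cvgMr.
  apply: (@continuous_comp _ _ _ (fun k : R => u * k ^+ 2 + c) sin).
    apply: cvgD; last exact: cvg_cst.
    by apply: cvgMr; exact: exprn_continuous.
  exact: continuous_sin.
have gE k : cos (u * k ^+ 2 + c) <= g k.
  rewrite /g lerDl mulr_ge0 ?invr_ge0 ?sqr_ge0// subr_ge0.
  exact: le_trans (ler_norm _) (bs _).
have N0 : 0 < N by exact: lt_trans dN.
have GN : G N <= 0.
  rewrite /G mulr_le0_ge0 ?invr_ge0 ?(ltW N0)// subr_le0.
  exact: le_trans (ler_norm _) (bs _).
have Gd : - G d <= (`|u| * d)^-1.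
  rewrite /G -mulNr opprB invfM ler_wpM2r ?invr_ge0 ?(ltW d0)//.
  have -> : `|u|^-1 = a + a by rewrite /a; field; rewrite normr_eq0.
  rewrite lerD2l lerNl.
  by have := bs (u * d ^+ 2 + c); rewrite ler_norml => /andP[].
clearbody G g.
have cgdN : {within `[d, N], continuous g}.
  apply: continuous_in_subspaceT => k; rewrite inE/= in_itv/= => /andP[dk _].
  by apply: cg; exact: lt_le_trans dk.
have gG : (\int[mu]_(k in `[d, N]) (g k)%:E = (G N)%:E - (G d)%:E)%E.
  apply: continuous_FTC2_is_derive => //.
  move=> k; rewrite in_itv/= => /andP[dk _]; apply: dG; exact: lt_le_trans dk.
have ig : mu.-integrable `[d, N] (EFin \o g).
  by apply: continuous_compact_integrable => //; exact: segment_compact.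
apply: (@le_trans _ _ (G N - G d)).
  rewrite -[leRHS]/(fine (G N - G d)%:E) EFinB -gG; apply: le_Rintegral => //.
  exact: integrable_cos_sqr.
by rewrite -[leRHS]add0r lerD.
Qed.

(** The split point [|u|^(-1/2)] balances the length of the initial interval
against the van der Corput bound on the rest. *)
Lemma fresnel_le (u c N : R) : u != 0 -> 0 <= N ->
  \int[mu]_(k in `[0, N]) cos (u * k ^+ 2 + c) <= 2 * `|u| `^ (- 2^-1).
Proof.
move=> u0 N0; set d := _ `^ _.
have nu0 : 0 < `|u| by rewrite normr_gt0.
have d0 : 0 < d by exact: powR_gt0.
have trivial (M : R) : 0 <= M -> \int[mu]_(k in `[0, M]) cos (u * k ^+ 2 + c) <= M.
  move=> M0; apply: (@le_trans _ _ (\int[mu]_(k in `[0, M]) 1)).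
    apply: le_Rintegral => //.
    - exact: integrable_cos_sqr.
    - apply: continuous_compact_integrable; first exact: segment_compact.
      by apply: continuous_subspaceT => x; exact: cvg_cst.
  rewrite Rintegral_cst// mul1r.
  have -> : fine (lebesgue_measure (`[0, M]%classic : set R)) = M => //.
  rewrite lebesgue_measure_itv/= lte_fin.
  by case: ltP => [_|M0']; rewrite ?sube0//; apply/eqP; rewrite eq_le M0 M0'.
have [Nd|dN] := leP N d.
  rewrite (le_trans (trivial _ N0))// (le_trans Nd)//.
  by rewrite ler_peMl ?(ltW d0)// ler1n.
have -> : `[0, N]%classic = `[0, d] `|` `]d, N].
  by rewrite (@itv_bndbnd_setU _ _ _ (BRight d)) ?bnd_simp// ltW.
rewrite Rintegral_setU//; last 2 first.
- rewrite -(@itv_bndbnd_setU _ _ _ (BRight d)) ?bnd_simp ?ltW//.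
  exact: integrable_cos_sqr.
- apply/disj_setPS => x [] /=; rewrite !in_itv/= => /andP[_ x1].
  by rewrite ltNge x1.
rewrite mulr_natl mulr2n lerD//; first exact: trivial (ltW d0).
rewrite Rintegral_itv_obnd_cbnd; last first.
  apply: integrableS (integrable_cos_sqr u c d N) => //.
  exact: subset_itv_oc_cc.
apply: le_trans (fresnel_tail_le c u0 d0 dN) _.
have dd : d * d = `|u|^-1.
  rewrite -powR_inv1 ?(ltW nu0)// /d -powRD; last by rewrite (gt_eqF nu0) implybT.
  by congr (_ `^ _); field.
by rewrite invfM -dd mulfK ?gt_eqF.
Qed.

(** The phase [c] gives the lower bound for free (shift by [pi]), and will give
the sine integral (shift by [- pi / 2]). *)
Lemma norm_fresnel_le (u c N : R) : u != 0 -> 0 <= N ->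
  `|\int[mu]_(k in `[0, N]) cos (u * k ^+ 2 + c)| <= 2 * `|u| `^ (- 2^-1).
Proof.
move=> u0 N0; rewrite ler_norml fresnel_le// andbT lerNl.
have := fresnel_le (c + pi) u0 N0.
under eq_Rintegral do rewrite addrA cosDpi -mulN1r.
by rewrite RintegralZl ?mulN1r//; exact: integrable_cos_sqr.
Qed.

End fresnel.

(** * Product measures *)

Section products.
Context d1 d2 (T1 : measurableType d1) (T2 : measurableType d2) (R : realType).
Variable m1 : {sigma_finite_measure set T1 -> \bar R}.
Variable m2 : {sigma_finite_measure set T2 -> \bar R}.

(** The product measure under a name of its own, so that it can be used as a
sigma-finite measure in a further product. *)
Definition sigma_finite_prod : set (T1 * T2) -> \bar R := (m1 \x m2)%E.

HB.instance Definition _ := Measure.on sigma_finite_prod.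

Let sigma_finite_prod_setT : sigma_finite [set: T1 * T2] sigma_finite_prod.
Proof.
have /sigma_finiteP[A [TA ndA Aoo]] := sigma_finiteT m1.
have /sigma_finiteP[B [TB ndB Boo]] := sigma_finiteT m2.
exists (fun n => A n `*` B n) => [|n].
  apply/seteqP; split => // -[x y] _.
  have [i _ Aix] : (\bigcup_n A n) x by rewrite -TA.
  have [j _ Bjy] : (\bigcup_n B n) y by rewrite -TB.
  exists (maxn i j) => //; split => /=.
    by move: Aix; apply/subsetPset/ndA; exact: leq_maxl.
  by move: Bjy; apply/subsetPset/ndB; exact: leq_maxr.
have [mA Afin] := Aoo n; have [mB Bfin] := Boo n.
split; first exact: measurableX.
rewrite [ltLHS](product_measure1E m1 m2 mA mB).
by rewrite lte_mul_pinfty// ge0_fin_numE.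
Qed.

HB.instance Definition _ := Measure_isSigmaFinite.Build _ _ _
  sigma_finite_prod sigma_finite_prod_setT.

Lemma integrable_prod_mul (f : T1 -> R) (g : T2 -> R) :
  m1.-integrable [set: T1] (EFin \o f) ->
  m2.-integrable [set: T2] (EFin \o g) ->
  (m1 \x m2)%E.-integrable [set: T1 * T2] (fun z => (f z.1 * g z.2)%:E).
Proof.
move=> /[dup] fi /integrableP[mf fi'] /[dup] gi /integrableP[mg gi'].
have mfg : measurable_fun [set: T1 * T2]
    (fun z : T1 * T2 => (f z.1 * g z.2)%:E).
  apply/measurable_EFinP; apply: measurable_funM.
    exact: (measurableT_comp ((measurable_EFinP _ _).1 mf) measurable_fst).
  exact: (measurableT_comp ((measurable_EFinP _ _).1 mg) measurable_snd).
apply/(integrable12ltyP m1 m2 mfg) => /=.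
under eq_integral.
  move=> x _.
  under eq_integral do rewrite normrM EFinM.
  rewrite ge0_integralZl//; last first.
    exact: (measurableT_comp (@abse_measurable R setT) mg).
  over.
rewrite ge0_integralZr//.
- apply: lte_mul_pinfty => //; first exact: integral_ge0.
  by rewrite ge0_fin_numE//; exact: integral_ge0.
- exact: (measurableT_comp (@abse_measurable R setT) mf).
- exact: integral_ge0.
Qed.

Lemma Rintegral_prod_mul (f : T1 -> R) (g : T2 -> R) :
  m1.-integrable [set: T1] (EFin \o f) ->
  m2.-integrable [set: T2] (EFin \o g) ->
  \int[(m1 \x m2)%E]_z (f z.1 * g z.2) = \int[m1]_x f x * \int[m2]_y g y.
Proof.
move=> fi gi.
have gE : (\int[m2]_y (g y)%:E = (\int[m2]_y g y)%:E)%E.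
  by rewrite fineK// integrable_fin_num.
rewrite {1}/Rintegral -integral12_prod_meas1; last exact: integrable_prod_mul.
rewrite /fubini_F/=.
under eq_integral.
  move=> x _; under eq_integral do rewrite EFinM.
  rewrite integralZl// gE -EFinM.
  over.
by rewrite -RintegralZr.
Qed.

Lemma measurable_fun_integral_fst (F : T1 * T2 -> \bar R) :
  measurable_fun [set: T1 * T2] F ->
  measurable_fun [set: T2] (fun y => \int[m1]_x F (x, y))%E.
Proof.
move=> mF; rewrite (_ : (fun y => _) = (fun y =>
    \int[m1]_x F^\+ (x, y) - \int[m1]_x F^\- (x, y)))%E; last first.
  apply/funext => y; rewrite [LHS]integralE.
  under eq_integral do rewrite funepos_comp/=.
  by under [X in (_ - X = _)%E]eq_integral do rewrite funeneg_comp/=.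
apply: emeasurable_funB.
  apply: measurable_fun_fubini_tonelli_G => //; exact: measurable_funepos.
apply: measurable_fun_fubini_tonelli_G => //; exact: measurable_funeneg.
Qed.

(** Domination by an integrable function of the first variable suffices because
[D] has finite measure. *)
Lemma Rintegral_exchange (D : set T2) (w : T1 * T2 -> R) (G : T1 -> R) :
  measurable D -> (m2 D < +oo)%E ->
  measurable_fun [set: T1 * T2] w -> m1.-integrable [set: T1] (EFin \o G) ->
  (forall x y, `|w (x, y)| <= G x) ->
  m1.-integrable [set: T1] (fun x => (\int[m2]_(y in D) w (x, y))%:E) /\
  (\int[m2]_(y in D) (\int[m1]_x w (x, y))%:E =
   \int[m1]_x (\int[m2]_(y in D) w (x, y))%:E)%E.
Proof.
move=> mD Dfin mw iG wG.
pose W z := w z * \1_D z.2.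
have m1D : measurable_fun [set: T1 * T2] (fun z : T1 * T2 => \1_D z.2 : R).
  by apply: measurableT_comp => //; exact: measurable_snd.
have mW : measurable_fun [set: T1 * T2] W by exact: measurable_funM.
have i1 : m2.-integrable [set: T2] (EFin \o \1_D).
  apply/integrableP; split; first exact/measurable_EFinP.
  under eq_integral do rewrite /= ger0_norm//.
  by rewrite integral_indic// setIT.
have iW : (m1 \x m2)%E.-integrable [set: T1 * T2] (EFin \o W).
  apply: le_integrable (integrable_prod_mul iG i1) => //.
    exact/measurable_EFinP.
  move=> [x y] _ /=; rewrite lee_fin !normrM ler_wpM2r//.
  by rewrite (le_trans (wG _ _))// ler_norm.
have WE x : (\int[m2]_(y in D) w (x, y))%:E =
    (\int[m2]_y (W (x, y))%:E)%E.
  rewrite fineK.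
    rewrite integral_mkcond; apply: eq_integral => y _.
    by rewrite patchE /W/= indicE; case: ifPn; rewrite ?mulr1// mulr0.
  apply: integrable_fin_num => //.
  apply: measurable_bounded_integrable => //.
    apply: measurable_funTS; apply: (measurableT_comp mw).
    exact: measurable_pair1.
  exists (G x); split; first exact: num_real.
  by move=> M GM y _ /=; rewrite (le_trans (wG _ _))// ltW.
split.
  by under eq_fun do rewrite WE; exact: (integrable_fubini_F iW).
under [RHS]eq_integral do rewrite WE.
rewrite [RHS](Fubini iW) integral_mkcond; apply: eq_integral => y _.
rewrite patchE /W/= indicE; case: ifPn => yD.
  under [RHS]eq_integral do rewrite mulr1.
  rewrite fineK//; apply: integrable_fin_num => //.
  apply: le_integrable iG => //.
    apply/measurable_EFinP; apply: (measurableT_comp mw).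
    exact: measurable_pair2.
  by move=> x _ /=; rewrite lee_fin (le_trans (wG _ _))// ler_norm.
by under [RHS]eq_integral do rewrite mulr0; rewrite integral0.
Qed.

End products.

(** * The square of a Fourier transform *)

Section wave_packets.
Context {R : realType}.
Local Notation mu := (@lebesgue_measure R).
Implicit Types (F : R -> R[i]) (v : R[i]).

Lemma cmod_ge0 v : 0 <= cmod v.
Proof. by case: v => a b; exact: sqrtr_ge0. Qed.

Lemma sqr_cmod v : cmod v ^+ 2 = complex.Re v ^+ 2 + complex.Im v ^+ 2.
Proof. by case: v => a b; rewrite sqr_sqrtr// addr_ge0// sqr_ge0. Qed.

Lemma Re_expiM (t : R) v : complex.Re (expi (- t) * v) =
  cos t * complex.Re v + sin t * complex.Im v.
Proof. by case: v => a b /=; rewrite cosN sinN mulNr opprK. Qed.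

Lemma Im_expiM (t : R) v : complex.Im (expi (- t) * v) =
  cos t * complex.Im v - sin t * complex.Re v.
Proof. by case: v => a b /=; rewrite cosN sinN mulNr. Qed.

(** [re_wave F x t] and [im_wave F x t] are the real and imaginary parts of
[exp (- i x t) F(x)]. *)
Definition re_wave F (x t : R) : R :=
  cos (x * t) * complex.Re (F x) + sin (x * t) * complex.Im (F x).

Definition im_wave F (x t : R) : R :=
  cos (x * t) * complex.Im (F x) - sin (x * t) * complex.Re (F x).

Lemma sqr_cmod_fourier F t : cmod (fourier F t) ^+ 2 =
  (\int[mu]_x re_wave F x t) ^+ 2 + (\int[mu]_x im_wave F x t) ^+ 2.
Proof.
by rewrite sqr_cmod /=; congr (_ ^+ 2 + _ ^+ 2); apply: eq_Rintegral => x _;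
  rewrite ?Re_expiM ?Im_expiM.
Qed.

Lemma norm_le_sqrt_sum (b c d : R) : 0 <= d -> c ^+ 2 + b ^+ 2 = d ^+ 2 ->
  `|c| <= d.
Proof.
move=> d0 cd; rewrite -(ger0_norm d0) -[leLHS]sqrtr_sqr -sqrtr_sqr.
by rewrite ler_wsqrtr// -cd lerDl sqr_ge0.
Qed.

Lemma waves_sqr F x t :
  re_wave F x t ^+ 2 + im_wave F x t ^+ 2 = cmod (F x) ^+ 2.
Proof.
rewrite sqr_cmod /re_wave /im_wave.
have := cos2Dsin2 (x * t).
move: (cos _) (sin _) (complex.Re _) (complex.Im _) => c s a b cs.
transitivity ((c ^+ 2 + s ^+ 2) * (a ^+ 2 + b ^+ 2)); first by ring.
by rewrite cs mul1r.
Qed.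

Lemma norm_re_wave_le F x t : `|re_wave F x t| <= cmod (F x).
Proof. exact: norm_le_sqrt_sum (cmod_ge0 _) (waves_sqr _ _ _). Qed.

Lemma norm_im_wave_le F x t : `|im_wave F x t| <= cmod (F x).
Proof.
apply: (@norm_le_sqrt_sum (re_wave F x t)); first exact: cmod_ge0.
by rewrite addrC waves_sqr.
Qed.

(** [gram_re F z] and [gram_im F z] are the real and imaginary parts of
[F(z.1) * conj F(z.2)]. *)
Definition gram_re F (z : R * R) : R :=
  complex.Re (F z.1) * complex.Re (F z.2) +
  complex.Im (F z.1) * complex.Im (F z.2).

Definition gram_im F (z : R * R) : R :=
  complex.Im (F z.1) * complex.Re (F z.2) -
  complex.Re (F z.1) * complex.Im (F z.2).

Lemma waves_gram F (x y t : R) :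
  re_wave F x t * re_wave F y t + im_wave F x t * im_wave F y t =
  cos ((x - y) * t) * gram_re F (x, y) + sin ((x - y) * t) * gram_im F (x, y).
Proof.
rewrite [(x - y) * t]mulrBl cosB sinB.
by rewrite /re_wave /im_wave /gram_re /gram_im/=; ring.
Qed.

Lemma gram_sqr F z : gram_re F z ^+ 2 + gram_im F z ^+ 2 =
  (cmod (F z.1) * cmod (F z.2)) ^+ 2.
Proof. by rewrite exprMn !sqr_cmod /gram_re /gram_im; ring. Qed.

Lemma norm_gram_re_le F z : `|gram_re F z| <= cmod (F z.1) * cmod (F z.2).
Proof.
apply: (@norm_le_sqrt_sum (gram_im F z)); last exact: gram_sqr.
by rewrite mulr_ge0 ?cmod_ge0.
Qed.

Lemma norm_gram_im_le F z : `|gram_im F z| <= cmod (F z.1) * cmod (F z.2).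
Proof.
apply: (@norm_le_sqrt_sum (gram_re F z)); first by rewrite mulr_ge0 ?cmod_ge0.
by rewrite addrC gram_sqr.
Qed.

Lemma gram_kernel_le F (N : R) (z : R * R) : 0 <= N -> z.1 != z.2 ->
  `|\int[mu]_(k in `[0, N])
     (cos ((z.1 - z.2) * k ^+ 2) * gram_re F z +
      sin ((z.1 - z.2) * k ^+ 2) * gram_im F z)| <=
  4 * (cmod (F z.1) * cmod (F z.2) * `|z.1 - z.2| `^ (- 2^-1)).
Proof.
move=> N0 z12; set u := z.1 - z.2.
have u0 : u != 0 by rewrite subr_eq0.
have iC : mu.-integrable `[0, N] (fun k => (cos (u * k ^+ 2))%:E).
  have := integrable_cos_sqr u 0 0 N.
  by apply: eq_integrable => // k _; rewrite addr0.
have iS : mu.-integrable `[0, N] (fun k => (sin (u * k ^+ 2))%:E).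
  have := integrable_cos_sqr u (- (pi / 2)) 0 N.
  by apply: eq_integrable => // k _; rewrite cosBpihalf.
rewrite RintegralD//; last 2 first.
- exact: (integrableZr _ (gram_re F z) iC).
- exact: (integrableZr _ (gram_im F z) iS).
rewrite !RintegralZr//.
have bC : `|\int[mu]_(k in `[0, N]) cos (u * k ^+ 2)| <= 2 * `|u| `^ (- 2^-1).
  have := norm_fresnel_le 0 u0 N0.
  by under eq_Rintegral do rewrite addr0.
have bS : `|\int[mu]_(k in `[0, N]) sin (u * k ^+ 2)| <= 2 * `|u| `^ (- 2^-1).
  have := norm_fresnel_le (- (pi / 2)) u0 N0.
  by under eq_Rintegral do rewrite cosBpihalf.
rewrite (le_trans (ler_normD _ _))// !normrM.
apply: (@le_trans _ _ (2 * `|u| `^ (- 2^-1) * (cmod (F z.1) * cmod (F z.2)) +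
    2 * `|u| `^ (- 2^-1) * (cmod (F z.1) * cmod (F z.2)))).
  by rewrite lerD// ler_pM// ?norm_gram_re_le ?norm_gram_im_le.
by rewrite le_eqVlt; apply/orP; left; apply/eqP; ring.
Qed.

End wave_packets.

(** * Restriction of the Fourier transform to squares *)

Section restriction.
Context {R : realType}.
Local Notation mu := (@lebesgue_measure R).
Local Notation mu2 := (mu \x mu)%E.

Lemma diagonal_null : mu2.-negligible [set z : R * R | z.1 = z.2].
Proof.
have me : measurable_fun [set: R * R] (fun z : R * R => z.1 == z.2).
  exact: (measurable_fun_eqr measurable_fst measurable_snd).
have mD : measurable [set z : R * R | z.1 = z.2].
  rewrite (_ : [set _ | _] =
      setT `&` (fun z : R * R => z.1 == z.2) @^-1` [set true]).
    exact: me.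
  by apply/seteqP; split => z /=; [move=> ->; rewrite eqxx|move=> [_ /eqP]].
apply/negligibleP => //.
rewrite /product_measure1/=.
apply: integral0_eq => x _ /=.
rewrite (_ : xsection _ x = [set x]) ?lebesgue_measure_set1//.
by apply/seteqP; split => y /=; rewrite /xsection/= inE/=.
Qed.

Context (F : R -> R[i])
  (mRe : measurable_fun [set: R] (fun x => complex.Re (F x)))
  (mIm : measurable_fun [set: R] (fun x => complex.Im (F x))).

Lemma measurable_re_wave :
  measurable_fun [set: R * R] (fun z => re_wave F z.1 z.2).
Proof.
have m12 : measurable_fun [set: R * R] (fun z : R * R => z.1 * z.2).
  exact: (measurable_funM measurable_fst measurable_snd).
have mC := measurableT_comp (continuous_measurable_fun (@continuous_cos R)) m12.
have mS := measurableT_comp (continuous_measurable_fun (@continuous_sin R)) m12.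
have mr := measurableT_comp mRe (@measurable_fst _ _ R R).
have mi := measurableT_comp mIm (@measurable_fst _ _ R R).
exact: (measurable_funD (measurable_funM mC mr) (measurable_funM mS mi)).
Qed.

Lemma measurable_im_wave :
  measurable_fun [set: R * R] (fun z => im_wave F z.1 z.2).
Proof.
have m12 : measurable_fun [set: R * R] (fun z : R * R => z.1 * z.2).
  exact: (measurable_funM measurable_fst measurable_snd).
have mC := measurableT_comp (continuous_measurable_fun (@continuous_cos R)) m12.
have mS := measurableT_comp (continuous_measurable_fun (@continuous_sin R)) m12.
have mr := measurableT_comp mRe (@measurable_fst _ _ R R).
have mi := measurableT_comp mIm (@measurable_fst _ _ R R).
exact: (measurable_funB (measurable_funM mC mi) (measurable_funM mS mr)).
Qed.

Lemma measurable_sqr_cmod_fourier :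
  measurable_fun [set: R] (fun t => cmod (fourier F t) ^+ 2).
Proof.
under eq_fun do rewrite sqr_cmod_fourier.
apply: measurable_funD; apply: measurable_funX.
  apply: (measurableT_comp (fine_measurable measurableT)).
  exact: (measurable_fun_integral_fst mu
    ((measurable_EFinP _ _).2 measurable_re_wave)).
apply: (measurableT_comp (fine_measurable measurableT)).
exact: (measurable_fun_integral_fst mu
    ((measurable_EFinP _ _).2 measurable_im_wave)).
Qed.

Lemma measurable_cmod : measurable_fun [set: R] (fun x => cmod (F x)).
Proof.
have -> : (fun x => cmod (F x)) = (fun x =>
    (complex.Re (F x) ^+ 2 + complex.Im (F x) ^+ 2) `^ 2^-1).
  apply/funext => x; rewrite -sqr_cmod powR12_sqrt ?sqr_ge0//.
  by rewrite sqrtr_sqr ger0_norm ?cmod_ge0.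
apply: (measurableT_comp (measurable_powR 2^-1)).
by apply: measurable_funD; exact: measurable_funX.
Qed.

Context (iF : mu.-integrable [set: R] (fun x => (cmod (F x))%:E)).

Lemma integrable_re_wave t :
  mu.-integrable [set: R] (fun x => (re_wave F x t)%:E).
Proof.
apply: le_integrable iF => //.
  apply/measurable_EFinP.
  exact: (measurableT_comp measurable_re_wave (measurable_pair2 t)).
move=> x _ /=; rewrite lee_fin (ger0_norm (cmod_ge0 _)).
exact: norm_re_wave_le.
Qed.

Lemma integrable_im_wave t :
  mu.-integrable [set: R] (fun x => (im_wave F x t)%:E).
Proof.
apply: le_integrable iF => //.
  apply/measurable_EFinP.
  exact: (measurableT_comp measurable_im_wave (measurable_pair2 t)).
move=> x _ /=; rewrite lee_fin (ger0_norm (cmod_ge0 _)).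
exact: norm_im_wave_le.
Qed.

Lemma sqr_cmod_fourier_gram t : cmod (fourier F t) ^+ 2 =
  \int[mu2]_z (cos ((z.1 - z.2) * t) * gram_re F z +
               sin ((z.1 - z.2) * t) * gram_im F z).
Proof.
rewrite sqr_cmod_fourier !expr2.
have ir := integrable_re_wave t; have ii := integrable_im_wave t.
rewrite -!Rintegral_prod_mul// -RintegralD//; last 2 first.
- exact: (integrable_prod_mul ir ir).
- exact: (integrable_prod_mul ii ii).
by apply: eq_Rintegral => -[x y] _; exact: waves_gram.
Qed.

Let measurable_form : measurable_fun [set: R * R] (fun z : R * R =>
  cmod (F z.1) * cmod (F z.2) * `|z.1 - z.2| `^ (- 2^-1)).
Proof.
exact: (measurable_funM (measurable_fun_prod_mul measurable_cmod measurable_cmod)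
  (@measurable_fun_riesz_kernel R)).
Qed.

(** For [k] between [0] and [N] everything is absolutely integrable, so the
[k]-integral may be taken first; it is a combination of truncated Fresnel
integrals with [u = z.1 - z.2], whose bounds do not depend on [N]. The diagonal,
where that bound fails, is a null set. *)
Lemma truncated_restriction_le (N : R) : 0 <= N ->
  (\int[mu]_(k in `[0%R, N]) (cmod (fourier F (k ^+ 2)) ^+ 2)%:E <=
   4%:E * \int[mu2]_z
     (cmod (F z.1) * cmod (F z.2) * `|z.1 - z.2| `^ (- 2^-1))%:E)%E.
Proof.
move=> N0.
pose w (zk : (R * R) * R) :=
  cos ((zk.1.1 - zk.1.2) * zk.2 ^+ 2) * gram_re F zk.1 +
  sin ((zk.1.1 - zk.1.2) * zk.2 ^+ 2) * gram_im F zk.1.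
pose G (z : R * R) := 2 * (cmod (F z.1) * cmod (F z.2)).
have wG z k : `|w (z, k)| <= G z.
  rewrite /w /G/= (le_trans (ler_normD _ _))// !normrM mulr_natl mulr2n.
  rewrite lerD//.
    rewrite -[leRHS]mul1r ler_pM ?norm_gram_re_le//.
    by rewrite ler_norml cos_geN1 cos_le1.
  rewrite -[leRHS]mul1r ler_pM ?norm_gram_im_le//.
  by rewrite ler_norml sin_geN1 sin_le1.
have mRe1 := measurableT_comp mRe (@measurable_fst _ _ R R).
have mRe2 := measurableT_comp mRe (@measurable_snd _ _ R R).
have mIm1 := measurableT_comp mIm (@measurable_fst _ _ R R).
have mIm2 := measurableT_comp mIm (@measurable_snd _ _ R R).
have mgr : measurable_fun [set: R * R] (gram_re F).
  exact: (measurable_funD (measurable_funM mRe1 mRe2) (measurable_funM mIm1 mIm2)).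
have mgi : measurable_fun [set: R * R] (gram_im F).
  exact: (measurable_funB (measurable_funM mIm1 mRe2) (measurable_funM mRe1 mIm2)).
have mdif : measurable_fun [set: R * R] (fun z : R * R => z.1 - z.2).
  exact: (measurable_funB measurable_fst measurable_snd).
have mw : measurable_fun [set: (R * R) * R] w.
  have mphase : measurable_fun [set: (R * R) * R]
      (fun zk : (R * R) * R => (zk.1.1 - zk.1.2) * zk.2 ^+ 2).
    apply: measurable_funM; first exact: (measurableT_comp mdif measurable_fst).
    exact: (measurable_funX 2 measurable_snd).
  have mC := measurableT_comp (continuous_measurable_fun (@continuous_cos R)) mphase.
  have mS := measurableT_comp (continuous_measurable_fun (@continuous_sin R)) mphase.
  exact: (measurable_funD (measurable_funM mC (measurableT_comp mgr measurable_fst))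
    (measurable_funM mS (measurableT_comp mgi measurable_fst))).
have iG : mu2.-integrable [set: R * R] (EFin \o G).
  exact: (integrableZl measurableT 2 (integrable_prod_mul iF iF)).
have muN : (mu `[0%R, N] < +oo)%E.
  rewrite -[mu _]/(lebesgue_measure `[0%R, N]%classic) lebesgue_measure_itv/=.
  by case: ifP => _; rewrite ltry.
have [iX E] := @Rintegral_exchange _ _ _ _ R (sigma_finite_prod mu mu) mu _ _ _
  (measurable_itv `[0, N]) muN mw iG wG.
under eq_integral do rewrite sqr_cmod_fourier_gram.
rewrite [leLHS]E.
have /integrableP[mX _] := iX.
apply: (le_trans (lee_abs _)); apply: (le_trans (le_abse_integral _ _ mX)) => //.
rewrite -ge0_integralZl//; last 2 first.
- exact/measurable_EFinP.
- by move=> z _; rewrite lee_fin !mulr_ge0 ?cmod_ge0 ?powR_ge0.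
apply: ae_ge0_le_integral => //.
- exact: (measurableT_comp (@abse_measurable R setT) mX).
- by move=> z _; rewrite -EFinM lee_fin !mulr_ge0 ?cmod_ge0 ?powR_ge0.
- by apply: measurable_funeM; exact/measurable_EFinP.
apply: negligibleS diagonal_null => z /= /not_implyP[_].
apply: contra_notP => /eqP z12.
by rewrite -EFinM lee_fin; exact: gram_kernel_le.
Qed.

(** The integrand is even, so the truncated integrals increase to half of the
left-hand side. *)
Lemma restriction_le :
  (\int[mu]_k (cmod (fourier F (k ^+ 2)) ^+ 2)%:E <=
   8%:E * \int[mu2]_z
     (cmod (F z.1) * cmod (F z.2) * `|z.1 - z.2| `^ (- 2^-1))%:E)%E.
Proof.
have mf : measurable_fun [set: R] (fun k => (cmod (fourier F (k ^+ 2)) ^+ 2)%:E).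
  apply/measurable_EFinP; apply: (measurableT_comp measurable_sqr_cmod_fourier).
  exact: exprn_measurable.
rewrite ge0_integral_even//; last 2 first.
- by move=> k; rewrite lee_fin sqr_ge0.
- by move=> k; rewrite sqrrN.
rewrite (_ : 8 = 2 * 4); last by ring.
rewrite EFinM -muleA lee_pmul2l// itv_bndy_bigcup_BRight.
apply: (cvge_to_le (ge0_nondecreasing_set_cvg_integral _ _ _ _)) => //.
- apply/nondecreasing_seqP => n; rewrite subsetEset => x/=.
  rewrite !in_itv/= !add0r => /andP[-> xn]; rewrite (le_trans xn)//.
  by rewrite ler_nat.
- by move=> n; exact: measurable_funTS.
- by move=> n x _; rewrite lee_fin sqr_ge0.
by apply: nearW => n; rewrite add0r; exact: truncated_restriction_le.
Qed.

End restriction.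

(** * Schwartz functions *)

Section schwartz_facts.
Context {R : realType}.
Local Notation mu := (@lebesgue_measure R).
Context (F : R -> R[i]) (sF : schwartz F).

Lemma schwartz_measurable_Re : measurable_fun [set: R] (fun x => complex.Re (F x)).
Proof.
apply: continuous_measurable_fun => x.
by have [/derivable1_diffP/differentiable_continuous] := sF.1 0%N x.
Qed.

Lemma schwartz_measurable_Im : measurable_fun [set: R] (fun x => complex.Im (F x)).
Proof.
apply: continuous_measurable_fun => x.
by have [_ /derivable1_diffP/differentiable_continuous] := sF.1 0%N x.
Qed.

Lemma schwartz_decay : exists M : R, 0 <= M /\
  forall x, cmod (F x) <= M * (oneDsqr x)^-1.
Proof.
have [_ decay] := sF.
have [A hA] := decay 0%N 0%N; have [B hB] := decay 2%N 0%N.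
have FE x : cderive1n 0 F x = F x by rewrite /cderive1n/=; case: (F x).
have bound x : cmod (F x) <= (A + B) * (oneDsqr x)^-1.
  rewrite ler_pdivlMr ?(lt_le_trans ltr01 (oneDsqr_ge1 x))//.
  rewrite /oneDsqr mulrDr mulr1 mulrC lerD//.
    by have := hA x; rewrite FE expr0 mul1r.
  by have := hB x; rewrite FE real_normK ?num_real.
exists (A + B); split => //.
by have := le_trans (cmod_ge0 _) (bound 0); rewrite pmulr_lge0 // invr_gt0
  (lt_le_trans ltr01 (oneDsqr_ge1 0)).
Qed.

Lemma schwartz_integrable : mu.-integrable [set: R] (fun x => (cmod (F x))%:E).
Proof.
have mc := (measurable_EFinP _ _).2
  (measurable_cmod schwartz_measurable_Re schwartz_measurable_Im).
have [M [M0 decay]] := schwartz_decay.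
have V0 x : 0 <= (oneDsqr x)^-1 :> R.
  by rewrite invr_ge0 (le_trans ler01 (oneDsqr_ge1 x)).
have mV : measurable_fun [set: R] (fun x : R => (oneDsqr x)^-1).
  exact: (continuous_measurable_fun continuous_oneDsqrV).
have iV : mu.-integrable [set: R] (fun x => ((oneDsqr x)^-1)%:E).
  apply/integrableP; split; first exact/measurable_EFinP.
  under eq_integral do rewrite /= ger0_norm//.
  rewrite ge0_integral_even//.
  - by rewrite integral0y_oneDsqr -EFinM ltry.
  - exact/measurable_EFinP.
  - by move=> x; rewrite /oneDsqr sqrrN.
apply: le_integrable (integrableZl measurableT M iV) => // x _ /=.
rewrite lee_fin ger0_norm ?cmod_ge0// ger0_norm ?mulr_ge0//.
Qed.

Lemma schwartz_cLnorm_lty (s : R) : 1 < s -> (cLnorm s F < +oo)%E.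
Proof.
move=> s1; have s0 : 0 < s by exact: lt_trans s1.
apply: (@lty_poweRy _ _ s); first by rewrite gt_eqF.
rewrite poweR_Lnorm ?gt_eqF//.
have [M [M0 decay]] := schwartz_decay.
have FM x : cmod (F x) <= M.
  apply: le_trans (decay x) _; rewrite ler_piMr//.
  by rewrite invf_le1 ?oneDsqr_ge1// (lt_le_trans ltr01 (oneDsqr_ge1 x)).
have mc := measurable_cmod schwartz_measurable_Re schwartz_measurable_Im.
have /integrableP[_] := integrableZl measurableT (M `^ (s - 1)) schwartz_integrable.
apply: le_lt_trans; apply: ge0_le_integral => //.
- by move=> x _; exact: poweR_ge0.
- rewrite (_ : (fun x => _) = (fun x => (cmod (F x) `^ s)%:E)).
    by apply/measurable_EFinP; exact: (measurableT_comp (measurable_powR s)).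
  by apply/funext => x; rewrite /= ger0_norm// cmod_ge0.
- apply: measurableT_comp => //; apply/measurable_EFinP.
  exact: measurable_funM.
move=> x _; rewrite /= lee_fin ger0_norm ?cmod_ge0//.
rewrite ger0_norm ?mulr_ge0 ?powR_ge0 ?cmod_ge0//.
rewrite -(mulr_powRB1 (cmod_ge0 _) s0) mulrC ler_wpM2r ?cmod_ge0//.
by rewrite ge0_ler_powR ?nnegrE ?cmod_ge0 ?FM// subr_ge0 ltW.
Qed.

End schwartz_facts.

(** * The inequality *)

Lemma restriction_le_cLnorm (R : realType) (q r : R) (F : R -> R[i]) :
  1 < q -> 1 < r -> q^-1 + r^-1 = 3 / 2 -> schwartz F ->
  (\int[@lebesgue_measure R]_k ((cmod (fourier F (k ^+ 2)) ^+ 2)%:E)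
   <= (8 * (1 + riesz_const q + riesz_const r))%:E *
      cLnorm q F * cLnorm r F)%E.
Proof.
move=> q1 r1 qr sF.
have mRe := schwartz_measurable_Re sF; have mIm := schwartz_measurable_Im sF.
apply: (le_trans (restriction_le mRe mIm (schwartz_integrable sF))).
rewrite EFinM -!muleA lee_pmul2l// muleA.
have mc := measurable_cmod mRe mIm.
apply: (hardy_littlewood_sobolev_half q1 r1 qr mc mc).
- by move=> x; exact: cmod_ge0.
- by move=> x; exact: cmod_ge0.
- exact: schwartz_cLnorm_lty.
- exact: schwartz_cLnorm_lty.
Qed.

Theorem lemma5p5 (R : realType) :
  (forall p : R, 1 < p ->
     exists C : R, forall q r : R, 1 < q -> 1 < r ->
       q^-1 + p^-1 = 1 -> p^-1 = r^-1 - 2^-1 ->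
       forall F : R -> R[i], schwartz F ->
         (\int[@lebesgue_measure R]_k ((cmod (fourier F (k ^+ 2)) ^+ 2)%:E)
            <= C%:E * cLnorm q F * cLnorm r F)%E)
  /\
  (exists C : R, forall F : R -> R[i], schwartz F ->
     ((\int[@lebesgue_measure R]_k ((cmod (fourier F (k ^+ 2)) ^+ 2)%:E)) `^ 2^-1
        <= C%:E * cLnorm (4 / 3) F)%E).
Proof.
split.
  move=> p p1; exists (8 * (1 + riesz_const (1 - p^-1)^-1 +
    riesz_const (p^-1 + 2^-1)^-1)) => q r q1 r1 qp pr F sF.
  have <- : q^-1 = 1 - p^-1 by rewrite -qp addrK.
  have <- : r^-1 = p^-1 + 2^-1 by rewrite pr subrK.
  rewrite !invrK; apply: restriction_le_cLnorm => //; lra.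
pose C : R := 8 * (1 + riesz_const (4 / 3) + riesz_const (4 / 3)).
exists (Num.sqrt `|C|) => F sF.
have q1 : 1 < 4 / 3 :> R by lra.
have qq : (4 / 3)^-1 + (4 / 3)^-1 = 3 / 2 :> R by field.
have := restriction_le_cLnorm q1 q1 qq sF; rewrite -/C.
have nfin := schwartz_cLnorm_lty sF q1.
have nE : cLnorm (4 / 3) F = (fine (cLnorm (4 / 3) F))%:E.
  by rewrite fineK// ge0_fin_numE// Lnorm_ge0.
have n0 : 0 <= fine (cLnorm (4 / 3) F) by rewrite fine_ge0// Lnorm_ge0.
rewrite nE; move: (fine _) n0 => n n0; set I := (\int[_]_k _)%E => le.
have I0 : (0 <= I)%E by apply: integral_ge0 => k _; rewrite lee_fin sqr_ge0.
have {le} : (I <= (`|C| * n ^+ 2)%:E)%E.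
  apply: (le_trans le); rewrite -!EFinM lee_fin -mulrA -expr2.
  by rewrite ler_wpM2r ?sqr_ge0// ler_norm.
have -> : ((Num.sqrt `|C|)%:E * n%:E = (`|C| * n ^+ 2)%:E `^ 2^-1)%E.
  rewrite poweR_EFin powR12_sqrt ?mulr_ge0 ?sqr_ge0// sqrtrM// sqrtr_sqr.
  by rewrite (ger0_norm n0).
move=> le; apply: gt0_ler_poweR => //.
- by rewrite in_itv/= I0 leey.
- by rewrite in_itv/= leey andbT lee_fin mulr_ge0 ?sqr_ge0.
Qed.
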